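(* For every even integer $d\ge 2$ and every odd integer $t\ge 5$, there exists a graph that does not contain the complete graph $K_t$ as a minor and that contains a distance-$d$ half graph of order $$ 2^{\binom{\frac12(d+t-7)}{\frac12(t-5)}}. $$
   Context: All graphs are finite, undirected and simple; $\mathrm{dist}$ is the shortest-path distance. For integers $d,\ell\ge1$, $2\ell$ pairwise distinct vertices $a_1,\dots,a_\ell,b_1,\dots,b_\ell$ of a graph form a distance-$d$ half graph of order $\ell$ if for all $i,j\in[1,\ell]$ we have $\mathrm{dist}(b_i,a_j)\le d$ if and only if $i<j$. *)

(* Defs.v *)
From mathcomp Require Import all_boot.

Set Implicit Arguments.
Unset Strict Implicit.
Unset Printing Implicit Defensive.

Record sgraph := SGraph {
  vertex :> finType;
  adj : rel vertex;
  adj_sym : symmetric adj;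
  adj_irr : irreflexive adj }.

Section Distance.
Variable G : sgraph.
Implicit Types x y : G.

Definition has_path x y n :=
  [exists p : n.-tuple G, [&& path (@adj G) x p, uniq (x :: p) & last x p == y]].

(* [None] stands for an infinite distance.  The vertices of a path are
   distinct, so no path has length [#|G|] or more. *)
Definition dist x y : option nat :=
  ohead [seq n <- iota 0 #|G| | has_path x y n].

Definition dist_le x y d := if dist x y is Some n then n <= d else false.

Lemma dist_leP x y d :
  reflect (exists p : seq G, [/\ path (@adj G) x p, last x p = y & size p <= d])
          (dist_le x y d).
Proof.
rewrite /dist_le /dist; apply: (iffP idP).
  case E: [seq _ <- _ | _] => [//|n s] /= le_nd.
  have: n \in [seq m <- iota 0 #|G| | has_path x y m] by rewrite E mem_head.
  rewrite mem_filter => /andP[/existsP[p /and3P[xp _ /eqP xpy]] _].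
  by exists p; rewrite size_tuple.
case=> p [xp xpy le_pd]; subst y.
case: (shortenP xp) => q xq uq sub_qp.
have le_qp : size q <= size p.
  by have /andP[_ /uniq_leq_size] := uq; apply; apply: sub_qp.
have lt_qG : size q < #|G|.
  by rewrite -[(size q).+1]/(size (x :: q)) -(card_uniqP uq) max_card.
have: size q \in [seq n <- iota 0 #|G| | has_path x (last x q) n].
  rewrite mem_filter mem_iota add0n lt_qG !andbT.
  apply/existsP.
  by exists (in_tuple q); rewrite xq uq eqxx.
have: sorted leq [seq n <- iota 0 #|G| | has_path x (last x q) n].
  by apply: sorted_filter; [exact: leq_trans | exact: iota_sorted].
case: [seq _ <- _ | _] => [|n s] //= /(order_path_min leq_trans)/allP le_ns.
rewrite inE => /predU1P[<-|/le_ns le_nq]; first exact: leq_trans le_qp le_pd.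
exact: leq_trans le_nq (leq_trans le_qp le_pd).
Qed.

Definition half_graph d l (a b : 'I_l -> G) : Prop :=
  [/\ injective a, injective b, forall i j, a i != b j
    & forall i j, dist_le (b i) (a j) d <-> i < j].

Definition contains_half_graph d l : Prop :=
  exists a b : 'I_l -> G, half_graph d a b.

Definition connected_set (S : {set G}) : Prop :=
  S != set0 /\
  {in S &, forall x y,
     connect [rel u v | [&& u \in S, v \in S & adj u v]] x y}.

End Distance.

(* [B] is a minor model of [H] in [G], with branch sets [B h]. *)
Definition contains_minor (H G : sgraph) : Prop :=
  exists B : H -> {set G},
    [/\ forall h, connected_set (B h),
        forall h k, h != k -> [disjoint B h & B k]
      & forall h k, adj h k ->
          exists x y, [/\ x \in B h, y \in B k & adj x y]].

Section Complete.
Variable t : nat.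

Let neq_ord : rel 'I_t := fun i j => i != j.

Fact neq_ord_sym : symmetric neq_ord.
Proof. by move=> i j; rewrite /neq_ord eq_sym. Qed.

Fact neq_ord_irr : irreflexive neq_ord.
Proof. by move=> i; rewrite /neq_ord eqxx. Qed.

Definition complete_graph := SGraph neq_ord_sym neq_ord_irr.

End Complete.

(* Main.v *)
(* Layer the graph so that distance-[2D] questions between the bottom and the top
   layer become questions about climbing paths.  Given a half graph with indices
   [i < l1] over [D] and one with indices [j < l2] over [D + 1], attach to the
   first, for each [i], a copy of the second, joining all its top vertices to
   [top i] and all its bottom vertices to [bot i].  Climbing reachability is then
   the lexicographic order on pairs [(i, j)], so orders multiply; by Pascal's rule
   [D] and [k] give order [2 ^ 'C(D + k - 1, D)], which is slightly more than
   required.  Each copy is glued along the (virtual) edge [top i -- bot i] after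
   adding two apices, so the width of a chordal completion grows by 2 with [k],
   and graphs with a chordal completion of width [w] have no [K_(w+2)] minor. *)
Require Import Defs.
From mathcomp Require Import all_boot zify.

Set Implicit Arguments.
Unset Strict Implicit.
Unset Printing Implicit Defensive.

(** * Reachability: induction and homomorphisms *)

Lemma connect_ind (T : finType) (e : rel T) (P : T -> Prop) x y :
  (forall u v, e u v -> P u -> P v) -> connect e x y -> P x -> P y.
Proof.
move=> Pe /connectP[p ep ->].
elim: p x ep => [|z p IHp] x //= /andP[xz zp] Px.
exact/IHp/Pe/Px.
Qed.

Lemma homo_connect (T T' : finType) (e : rel T) (e' : rel T') (f : T -> T') :
    {homo f : x y / e x y >-> connect e' x y} ->
  {homo f : x y / connect e x y >-> connect e' x y}.
Proof.
move=> fe x y; move/(connect_ind (P := fun z => connect e' (f x) (f z))).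
by apply=> [u v /fe uv xu|]; [apply: connect_trans xu uv | apply: connect0].
Qed.

(** * Elimination orderings and clique minors *)

Section Elimination.
Variables (T : finType) (e : rel T) (r : T -> nat) (w : nat).

Definition later u := [set v | e u v & r u < r v].

(** A perfect elimination ordering, witnessing that [e] is chordal with cliques of at most [w + 1]
    vertices. Ranks need only differ along edges, so disjoint pieces may share them. *)
Definition elimination :=
  [/\ symmetric e, forall u v, e u v -> r u != r v,
      forall u, {in later u &, forall v z, v != z -> e v z}
    & forall u, #|later u| <= w].

Definition within (S : {set T}) : rel T :=
  [rel u v | [&& u \in S, v \in S & e u v]].

Hypothesis elim_e : elimination.

Lemma min_rank_later (S : {set T}) v z :
  {in S, forall x, r v <= r x} -> z \in S -> e v z -> z \in later v.
Proof.
case: elim_e => _ er _ _ v_min Sz evz.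
by rewrite inE evz ltn_neqAle er ?v_min.
Qed.

(* The vertex [v] is retracted onto its neighbour [z]; all other neighbours of
   [v] in [S] are adjacent to [z]. *)
Lemma connect_within_del (S : {set T}) v z :
    {in S, forall x, r v <= r x} -> z \in S -> e v z ->
    {in S &, forall x y, connect (within S) x y} ->
  {in S :\ v &, forall x y, connect (within (S :\ v)) x y}.
Proof.
move=> v_min Sz evz S_conn x y; rewrite !in_setD1 => /andP[xv Sx] /andP[yv Sy].
case: (elim_e) => e_sym er e_clique _.
have zv : z != v by apply: contraTneq evz => ->; apply/negP => /er; rewrite eqxx.
pose f u := if u == v then z else u.
suff: connect (within (S :\ v)) (f x) (f y) by rewrite /f (negPf xv) (negPf yv).
apply: homo_connect (S_conn _ _ Sx Sy) => u1 u2 /and3P[Su1 Su2 e12].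
rewrite /f; have [u1v|u1v] := eqVneq u1 v; have [u2v|u2v] := eqVneq u2 v => //.
- have [->//|zu2] := eqVneq z u2.
  apply: connect1; rewrite /within /= !in_setD1 zv u2v Sz Su2 /=.
  apply: (e_clique v) => //; apply: (min_rank_later v_min) => //.
  by rewrite -u1v.
- have [->//|u1z] := eqVneq u1 z.
  apply: connect1; rewrite /within /= !in_setD1 zv u1v Sz Su1 /=.
  apply: (e_clique v) => //; apply: (min_rank_later v_min) => //.
  by rewrite -u2v e_sym.
- by apply: connect1; rewrite /within /= !in_setD1 u1v u2v Su1 Su2.
Qed.

(* Induction on the total size of the branch sets: a vertex of least rank is
   either a whole branch set, which then has at most [w] neighbours, or can be
   deleted from its branch set. *)
Lemma elimination_clique_minor t (B : 'I_t -> {set T}) :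
    (forall h, B h != set0) ->
    (forall h, {in B h &, forall x y, connect (within (B h)) x y}) ->
    (forall h k, h != k -> [disjoint B h & B k]) ->
    (forall h k, h != k -> exists x y, [/\ x \in B h, y \in B k & e x y]) ->
  t <= w.+1.
Proof.
case: (elim_e) => e_sym er e_clique e_w.
have [n] := ubnP (\sum_h #|B h|); elim: n B => // n IHn B lt_n B0 Bc Bd Be.
case: t B lt_n B0 Bc Bd Be IHn => // t B lt_n B0 Bc Bd Be IHn.
have [x0 x0B] := set0Pn _ (B0 ord0).
have x0U : x0 \in \bigcup_h B h by apply/bigcupP; exists ord0.
case: (arg_minnP r x0U) => v /bigcupP[h _ vBh] v_min.
have v_minB k : {in B k, forall x, r v <= r x}.
  by move=> x xBk; apply: v_min; apply/bigcupP; exists k.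
have [Bh1|[z zBh evz]] : B h = [set v] \/ exists2 z, z \in B h & e v z.
- have [Bv|] := eqVneq (B h :\ v) set0.
    by left; rewrite -(setD1K vBh) Bv setU0.
  case/set0Pn=> u; rewrite in_setD1 => /andP[uv uBh]; right.
  have /connectP[[|z p] /=] := Bc h _ _ vBh uBh.
    by move=> _ uv'; rewrite uv' eqxx in uv.
  by case/andP=> /and3P[_ zBh evz] _ _; exists z.
(* If [B h] is [v] alone, one neighbour of [v] in each other branch set gives an injection into
   [later v]. The default [v] only arises for [k = h]. *)
- pose nb k := odflt v [pick y in B k | e v y].
  have nbP k : k != h -> nb k \in B k /\ e v (nb k).
    move=> kh; rewrite /nb; case: pickP => [y /andP[]//|no].
    have [|x [y [xBh yBk exy]]] := Be h k; first by rewrite eq_sym.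
    by move: xBh (no y); rewrite Bh1 inE => /eqP<-; rewrite yBk exy.
  have nb_inj : {in [set~ h] &, injective nb}.
    move=> k1 k2; rewrite !in_setC1 => /nbP[nb1 _] /nbP[nb2 _] nb12.
    apply/eqP; apply: contraTT nb2 => k12; rewrite -nb12.
    by rewrite (disjointFr (Bd _ _ k12)).
  rewrite ltnS; apply: leq_trans _ (e_w v).
  rewrite (_ : t = #|[set~ h]|); last by rewrite cardsC1 card_ord.
  rewrite -(card_in_imset nb_inj).
  apply/subset_leq_card/subsetP => _ /imsetP[k kh ->].
  rewrite in_setC1 in kh; have [nbB enb] := nbP k kh.
  exact: min_rank_later (v_minB k) _ _.
- have zv : z != v by apply: contraTneq evz => ->; apply/negP => /er; rewrite eqxx.
  pose B' k := B k :\ v.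
  have B'E k : k != h -> B' k = B k.
    move=> kh; apply/setP => x; rewrite in_setD1.
    by case: eqP => // ->; rewrite (disjointFl (Bd _ _ kh) vBh).
  have zB' : z \in B' h by rewrite in_setD1 zv.
  have B'h k : h != k -> exists x y, [/\ x \in B' h, y \in B' k & e x y].
    move=> hk; have kh : k != h by rewrite eq_sym.
    have [x [y [xBh yBk exy]]] := Be h k hk; rewrite (B'E k kh).
    have [xv|xv] := eqVneq x v; last by exists x, y; rewrite in_setD1 xv.
    (* An edge leaving from [v] is replaced by one from [z]: both [z] and [y] are later neighbours
       of [v], hence adjacent. *)
    exists z, y; split=> //; apply: (e_clique v).
    + exact: min_rank_later (v_minB h) _ _.
    + by apply: min_rank_later (v_minB k) _ _; rewrite // -xv.
    + by apply: contraTneq zBh => ->; rewrite (disjointFl (Bd _ _ hk) yBk).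
  apply: (IHn B').
  + rewrite -ltnS; apply: leq_trans lt_n; rewrite !ltnS [X in _ <= X](bigD1 h) //=.
    rewrite (bigD1 h) //= (cardsD1 v (B h)) vBh add1n addSn ltnS leq_add2l.
    by apply: leq_sum => k /B'E->.
  + move=> k; have [->|/B'E->//] := eqVneq k h.
    by apply/set0Pn; exists z.
  + move=> k; have [->|/B'E->//] := eqVneq k h.
    exact: connect_within_del (v_minB h) zBh evz (Bc h).
  + move=> k1 k2 k12; apply: disjointWl (subD1set _ _) _.
    by apply: disjointWr (subD1set _ _) _; apply: Bd.
  + move=> k1 k2 k12; have [k1h|k1h] := eqVneq k1 h.
      by rewrite k1h; apply: B'h; rewrite -k1h.
    have [k2h|k2h] := eqVneq k2 h; last by rewrite !B'E //; apply: Be.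
    have [|x [y [xB yB exy]]] := B'h k1; first by rewrite eq_sym.
    by exists y, x; rewrite k2h e_sym.
Qed.

End Elimination.

Lemma no_complete_minor (G : sgraph) (e : rel G) (r : G -> nat) w t :
    elimination e r w -> subrel (@adj G) e -> w.+1 < t ->
  ~ contains_minor (complete_graph t) G.
Proof.
move=> elim_e adj_e; rewrite ltnNge => /negP w_lt_t [B [Bc Bd Be]]; apply: w_lt_t.
apply: (elimination_clique_minor elim_e (B := B)) => [h|h x y xB yB|//|h k hk].
- by case: (Bc h).
- apply: connect_sub (proj2 (Bc h) x y xB yB) => u v /and3P[uB vB /adj_e uv].
  by apply: connect1; rewrite /within /= uB vB.
- by have [x [y [xB yB /adj_e xy]]] := Be h k hk; exists x, y.
Qed.

(** * Layered graphs and their half graphs *)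

Definition up (G : sgraph) (level : G -> nat) : rel G :=
  [rel x y | adj x y && (level y == (level x).+1)].

(* In a graph layered by [level], paths of length [D.*2] from level [0] to level
   [D.*2] climb at each step, so distances become reachability along [up].
   The edges of [fill] outside [adj] only serve to bound the clique minors. *)
Record ladder (D w l : nat) := Ladder {
  base :> sgraph;
  level : base -> nat;
  rank : base -> nat;
  fill : rel base;
  top : 'I_l -> base;
  bot : 'I_l -> base;
  adj_level : forall x y, adj x y ->
    level y = (level x).+1 \/ level x = (level y).+1;
  level_le : forall x, level x <= D.*2;
  level_top : forall i, level (top i) = D.*2;
  level_bot : forall i, level (bot i) = 0;
  top_inj : injective top;
  bot_inj : injective bot;
  up_ltn : forall i j, connect (up level) (bot i) (top j) = (i < j);
  fill_elim : elimination fill rank w;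
  fill_adj : subrel (@adj base) fill;
  fill_top_bot : forall i, fill (top i) (bot i) }.

Lemma ladder_half_graph D w l (G : ladder D w l) :
  0 < D -> half_graph D.*2 (@top _ _ _ G) (@bot _ _ _ G).
Proof.
move=> D0; split; [exact: top_inj | exact: bot_inj | | ].
  (* Positive height separates tops from bottoms; at height 0 they may coincide. *)
  move=> i j; apply/eqP => /(congr1 (@level _ _ _ G)).
  by rewrite level_top level_bot; lia.
move=> i j; rewrite -(up_ltn G).
have adj_le (x : G) p : path (@adj G) x p -> level (last x p) <= level x + size p.
  elim: p x => [|y p IHp] x /=; first by rewrite addn0.
  by case/andP=> /adj_level xy /IHp; case: xy => ->; lia.
have adj_up (x : G) p : path (@adj G) x p ->
    level (last x p) = level x + size p -> path (up (@level _ _ _ G)) x p.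
  elim: p x => //= y p IHp x /andP[xy yp] eq_last.
  have le_last := adj_le _ _ yp; rewrite /up /= xy.
  have yx : level y = (level x).+1.
    by case: (adj_level xy) => //; lia.
  by rewrite yx eqxx IHp //; lia.
have up_level (x : G) p : path (up (@level _ _ _ G)) x p ->
    level (last x p) = level x + size p.
  elim: p x => [|y p IHp] x /=; first by rewrite addn0.
  by case/andP=> /andP[_ /eqP xy] /IHp ->; lia.
split=> [/dist_leP[p [jp pi le_p]] | /connectP[p jp pi]].
  apply/connectP; exists p; last by rewrite pi.
  apply: adj_up => //.
  have := adj_le _ _ jp; rewrite pi level_top level_bot; lia.
apply/dist_leP; exists p; split=> //.
  by apply: sub_path jp => x y /andP[].
by have := up_level _ _ jp; rewrite -pi level_top level_bot; lia.
Qed.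

Lemma elimination_widen (T : finType) (e : rel T) r w w' :
  w <= w' -> elimination e r w -> elimination e r w'.
Proof.
by move=> le_w [es er ec ew]; split=> // u; apply: leq_trans (ew u) le_w.
Qed.

Definition widen_ladder D w w' l (le_w : w <= w') (G : ladder D w l) :
    ladder D w' l :=
  Ladder (@adj_level _ _ _ G) (@level_le _ _ _ G) (@level_top _ _ _ G)
    (@level_bot _ _ _ G) (@top_inj _ _ _ G) (@bot_inj _ _ _ G) (@up_ltn _ _ _ G)
    (elimination_widen le_w (fill_elim G)) (@fill_adj _ _ _ G)
    (@fill_top_bot _ _ _ G).

(** * Base ladders *)

Definition succ_rel n : rel 'I_n :=
  fun i j => (j == i.+1 :> nat) || (i == j.+1 :> nat).

Lemma succ_elimination n : elimination (@succ_rel n) (@nat_of_ord n) 1.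
Proof.
split=> [i j|i j|i j k|i]; rewrite /succ_rel /=.
- by rewrite orbC.
- by lia.
- by rewrite !inE /succ_rel /= => ij ik /eqP[]; apply: val_inj => /=; lia.
- apply/card_le1_eqP => j k; rewrite !inE /succ_rel /= => ij ik.
  by apply: val_inj => /=; lia.
Qed.

Definition empty_graph (n : nat) : sgraph.
Proof. by exists 'I_n (fun _ _ => false). Defined.

Lemma empty_connect n (lev : 'I_n -> nat) (x y : empty_graph n) :
  connect (@up (empty_graph n) lev) x y = (x == y).
Proof.
apply/idP/eqP => [/connectP[[|z p] //= /andP[]//]|->]; exact: connect0.
Qed.

(** With a single index the top must be unreachable from the bottom, so two isolated vertices
    suffice; the only edge of the completion is the virtual one. *)
Definition trivial_ladder D : 0 < D -> ladder D 1 1.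
Proof.
move=> D0; apply: (@Ladder D 1 1 (empty_graph 2) (fun i => i * D.*2)
  (@nat_of_ord 2) (@succ_rel 2) (fun _ => ord_max) (fun _ => ord0)) => //=.
- by case=> [[|[]]] //= _; lia.
- by move=> _; rewrite mul1n.
- by move=> i j _; rewrite !ord1.
- by move=> i j _; rewrite !ord1.
- by move=> i j; rewrite empty_connect !ord1.
- exact: succ_elimination.
Qed.

(** At height 0 climbing reachability is equality. With [top i] the vertex [i] and [bot i] the
    vertex [i + 1], equality means [j = i + 1], which on two indices is [i < j]. *)
Definition flat_ladder : ladder 0 1 2.
Proof.
apply: (@Ladder 0 1 2 (empty_graph 3) (fun=> 0) (@nat_of_ord 3) (@succ_rel 3)
  (widen_ord (leqnSn 2)) (lift ord0)) => //=.
- by move=> i j /(congr1 val)/= /val_inj.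
- exact: lift_inj.
- move=> i j; rewrite empty_connect -val_eqE /= /bump /= add1n.
  by case: i j => [[|[|?]] ?] [[|[|?]] ?].
- exact: succ_elimination.
- by move=> i; rewrite /succ_rel /= /bump /= add1n eqxx.
Qed.

(** * Gluing copies of one ladder onto another *)

Section Glue.
Variables (D w w' l1 l2 : nat) (G1 : ladder D w l1) (G2 : ladder D.+1 w' l2).
Hypothesis le_w : w'.+2 <= w.

Definition link (i : 'I_l1) (v : G2) (u : G1) :=
  (u == top G1 i) && (v \in codom (top G2))
  || (u == bot G1 i) && (v \in codom (bot G2)).

Definition glue_adj : rel (G1 + 'I_l1 * G2)%type := fun x y =>
  match x, y with
  | inl u, inl v => adj u v
  | inl u, inr (i, v) | inr (i, v), inl u => link i v u
  | inr (i, u), inr (j, v) => (i == j) && adj u v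
  end.

Fact glue_adj_sym : symmetric glue_adj.
Proof.
by case=> [u|[i u]] [v|[j v]] //=; rewrite adj_sym // eq_sym.
Qed.

Fact glue_adj_irr : irreflexive glue_adj.
Proof. by case=> [u|[i u]] /=; rewrite adj_irr // andbF. Qed.

Definition glue_graph : sgraph := SGraph glue_adj_sym glue_adj_irr.

(** Raising [G1] by one level places it strictly between the bottoms of the copies, at level 0, and
    their tops, at level [2D + 2]. *)
Definition glue_level (x : glue_graph) : nat :=
  match x with inl u => (level u).+1 | inr (_, v) => level v end.

(** The offset makes every copy of [G2] come before all of [G1] in the elimination. *)
Definition glue_rank (x : glue_graph) : nat :=
  match x with
  | inl u => (\max_v @rank _ _ _ G2 v).+1 + rank u
  | inr (_, v) => rank v
  end.

(** Here [top G1 i] and [bot G1 i] become apices over the whole copy [i], not just over its tops and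
    bottoms. *)
Definition glue_fill : rel glue_graph := fun x y =>
  match x, y with
  | inl u, inl v => fill u v
  | inl u, inr (i, _) | inr (i, _), inl u => (u == top G1 i) || (u == bot G1 i)
  | inr (i, u), inr (j, v) => (i == j) && fill u v
  end.

Fact div_ord_proof (i : 'I_(l1 * l2)) : i %/ l2 < l1.
Proof. by rewrite ltn_divLR //; case: l2 i => //; rewrite muln0 => -[]. Qed.

Fact mod_ord_proof (i : 'I_(l1 * l2)) : i %% l2 < l2.
Proof. by rewrite ltn_mod; case: l2 i => //; rewrite muln0 => -[]. Qed.

(** Euclidean division by [l2] encodes pairs of indices so that the order on ['I_(l1 * l2)] is
    lexicographic. *)
Definition div_ord i := Ordinal (div_ord_proof i).
Definition mod_ord i := Ordinal (mod_ord_proof i).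

Fact div_mod_ord_inj i j : div_ord i = div_ord j -> mod_ord i = mod_ord j -> i = j.
Proof.
move=> /(congr1 val)/= ijd /(congr1 val)/= ijm; apply: val_inj.
by rewrite /= (divn_eq i l2) ijd ijm -divn_eq.
Qed.

Fact ltn_div_mod_ord (i j : 'I_(l1 * l2)) :
  (i < j) = (div_ord i < div_ord j)
            || (div_ord i == div_ord j) && (mod_ord i < mod_ord j).
Proof.
rewrite -val_eqE /= {1}(divn_eq i l2) {1}(divn_eq j l2).
have := mod_ord_proof i; have := mod_ord_proof j.
move: (i %% l2) (j %% l2) (i %/ l2) (j %/ l2) => m n p q; nia.
Qed.

Definition glue_top (i : 'I_(l1 * l2)) : glue_graph :=
  inr (div_ord i, top G2 (mod_ord i)).
Definition glue_bot (i : 'I_(l1 * l2)) : glue_graph :=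
  inr (div_ord i, bot G2 (mod_ord i)).

Fact glue_link_level i v u : link i v u ->
  level v = (level u).+2 /\ u = top G1 i /\ v \in codom (top G2)
  \/ level v = level u /\ u = bot G1 i.
Proof.
case/orP=> /andP[/eqP-> /codomP[j ->]]; [left | right].
  by rewrite !level_top doubleS codom_f.
by rewrite !level_bot.
Qed.

Fact glue_adj_level (x y : glue_graph) : adj x y ->
  glue_level y = (glue_level x).+1 \/ glue_level x = (glue_level y).+1.
Proof.
case: x y => [u|[i u]] [v|[j v]] /=.
- by case/adj_level=> ->; [left | right].
- by case/glue_link_level=> -[-> _]; [left | right].
- by case/glue_link_level=> -[-> _]; [right | left].
- by case/andP=> _ /adj_level.
Qed.

Fact glue_level_le x : glue_level x <= D.+1.*2.
Proof.
case: x => [u|[i v]] /=; last exact: level_le.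
by have := level_le u; lia.
Qed.

(* A climbing path either stays in the copy of [G2] where it starts, or leaves
   it at once for [G1], which it can only leave at the top of another copy. *)
Definition glue_reach (i : 'I_l1) (k : 'I_l2) (x : glue_graph) : Prop :=
  match x with
  | inl u => connect (up (@level _ _ _ G1)) (bot G1 i) u
  | inr (j, v) => i = j /\ connect (up (@level _ _ _ G2)) (bot G2 k) v
     \/ i < j /\ v \in codom (top G2)
  end.

Fact glue_reach_up i k x y :
  up glue_level x y -> glue_reach i k x -> glue_reach i k y.
Proof.
case: x y => [u|[j u]] [v|[j' v]] /andP[] /=.
- move=> uv lev iu; apply: connect_trans iu (connect1 _).
  by rewrite /up /= uv -eqSS.
- case/glue_link_level=> -[-> ]; last by lia.
  by case=> -> v_top _; rewrite up_ltn; right.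
- case/glue_link_level=> -[lev_u ]; first by rewrite lev_u; lia.
  move=> eq_v _ [[-> _]|[_ /codomP[k' eq_u]]]; first by rewrite eq_v connect0.
  by move: lev_u; rewrite eq_u eq_v level_top level_bot.
- case/andP=> /eqP<- uv lev [[ij ku]|[_ /codomP[k' eq_u]]].
    left; split=> //; apply: connect_trans ku (connect1 _).
    by rewrite /up /= uv.
  (* A top of a copy has maximal level, so no climb continues from it. *)
  by have := level_le v; rewrite (eqP lev) eq_u level_top ltnn.
Qed.

Fact glue_up_ltn i j :
  connect (up glue_level) (glue_bot i) (glue_top j) = (i < j).
Proof.
rewrite ltn_div_mod_ord; apply/idP/orP.
  move/(connect_ind (@glue_reach_up (div_ord i) (mod_ord i))) => /=.
  case=> [|[-> +]|[-> _]]; [by left; rewrite connect0 | | by left].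
  by rewrite up_ltn => ->; rewrite eqxx; right.
case=> [ij|/andP[/eqP ij ltm]]; rewrite /glue_bot /glue_top.
  (* To a later copy: step onto [bot G1], climb inside [G1], then step from [top G1] to the target.
     Within one copy, the climb of [G2] is used. *)
  apply: (@connect_trans _ _ (inl (bot G1 (div_ord i)))).
    apply: connect1; rewrite /up /= !level_bot eqxx andbT.
    by rewrite /link eqxx codom_f orbT.
  apply: (@connect_trans _ _ (inl (top G1 (div_ord j)))); last first.
    apply: connect1; rewrite /up /= !level_top doubleS eqxx andbT.
    by rewrite /link eqxx codom_f.
  move: ij; rewrite -(up_ltn G1); apply: (homo_connect (f := inl)) => u v uv.
  exact: connect1.
rewrite ij; move: ltm; rewrite -(up_ltn G2).
apply: (homo_connect (f := fun v => inr (div_ord j, v))) => u v uv.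
by apply: connect1; rewrite /up /= eqxx.
Qed.

Fact glue_fill_sym : symmetric glue_fill.
Proof.
case: (fill_elim G1) (fill_elim G2) => s1 _ _ _ [s2 _ _ _].
by case=> [u|[i u]] [v|[j v]] //=; rewrite ?s1 // s2 eq_sym.
Qed.

Fact rank_ltn_max (u : G1) (v : G2) i :
  glue_rank (inr (i, v)) < glue_rank (inl u).
Proof. by rewrite /= addSn ltnS (leq_trans (leq_bigmax v)) ?leq_addr. Qed.

(** A vertex of a copy gains just its two apices as later neighbours, and these are joined by the
    virtual edge; a vertex of [G1] gains none. *)
Fact glue_elim : elimination glue_fill glue_rank w.
Proof.
case: (fill_elim G1) (fill_elim G2) => s1 r1 c1 w1 [s2 r2 c2 w2].
split.
- exact: glue_fill_sym.
- case=> [u|[i u]] [v|[j v]]; rewrite 1?[_ == glue_rank (inl _)]eq_sym.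
  + by move=> /= /r1; rewrite eqn_add2l eq_sym.
  + by move=> _; rewrite eq_sym neq_ltn rank_ltn_max.
  + by move=> _; rewrite eq_sym neq_ltn rank_ltn_max.
  + by case/andP=> _ /r2.
- have top_bot i u v : (u == top G1 i) || (u == bot G1 i) ->
      (v == top G1 i) || (v == bot G1 i) -> u != v -> fill u v.
    by do 2![case/orP=> /eqP->]; rewrite ?eqxx ?fill_top_bot // s1 fill_top_bot.
  (* The ranks exclude a later neighbour in a copy for a vertex of [G1], leaving five of the eight
     cases. *)
  case=> [u|[i u]] [v|[j v]] [z|[k z]]; rewrite !inE;
    rewrite 2?[_ < glue_rank (inr _)]ltnNge ?(ltnW (rank_ltn_max _ _ _)) ?andbF //=.
  + by rewrite !ltn_add2l => uv uz vz; apply: (c1 u); rewrite ?inE.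
  + by case/andP=> vi _ /andP[zi _]; apply: top_bot vi zi.
  + by case/andP=> vi _ /andP[/andP[/eqP<- _] _] _.
  + by case/andP=> /andP[/eqP<- _] _ /andP[zi _] _.
  + rewrite -!ltnNge => /andP[/andP[/eqP<- uv] lt_uv] /andP[/andP[/eqP<- uz] lt_uz] vz.
    rewrite eqxx; apply: (c2 u); rewrite ?inE ?uv ?uz //.
    by apply: contraNneq vz => ->.
- case=> [u|[i u]].
  + apply: leq_trans (w1 u); rewrite -(card_imset _ (@inl_inj G1 ('I_l1 * G2)%type)).
    apply/subset_leq_card/subsetP => -[v|[j v]]; rewrite inE.
      by rewrite /= ltn_add2l => uv; apply: imset_f; rewrite inE.
    by rewrite ltnNge (ltnW (rank_ltn_max _ _ _)) andbF.
  + apply: leq_trans le_w; rewrite -addn2.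
    pose A : {set glue_graph} :=
      (fun v => inr (i, v)) @: later (@fill _ _ _ G2) (@rank _ _ _ G2) u.
    pose B : {set glue_graph} := [set inl (top G1 i); inl (bot G1 i)].
    apply: (@leq_trans #|A :|: B|).
      apply/subset_leq_card/subsetP => -[v|[j v]]; rewrite !inE.
        by case/andP=> /orP[]/eqP-> _; rewrite eqxx ?orbT.
      move=> /= /andP[/andP[/eqP<- uv] lt_uv]; rewrite imset_f // inE uv //.
    apply: leq_trans (leq_card_setU _ _) _; apply: leq_add.
      exact: leq_trans (leq_imset_card _ _) (w2 u).
    by rewrite cards2; case: (_ != _).
Qed.

Definition glue : ladder D.+1 w (l1 * l2).
Proof.
apply: (@Ladder _ _ _ glue_graph glue_level glue_rank glue_fill glue_top glue_bot).
- exact: glue_adj_level.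
- exact: glue_level_le.
- by move=> i /=; rewrite level_top.
- by move=> i /=; rewrite level_bot.
- by move=> i j [ijd /top_inj ijm]; apply: div_mod_ord_inj; first exact: val_inj.
- by move=> i j [ijd /bot_inj ijm]; apply: div_mod_ord_inj; first exact: val_inj.
- exact: glue_up_ltn.
- exact: glue_elim.
- case=> [u|[i u]] [v|[j v]] /=.
  + exact: fill_adj.
  + by case/orP=> /andP[->]; rewrite ?orbT.
  + by case/orP=> /andP[->]; rewrite ?orbT.
  + by case/andP=> -> /fill_adj.
- by move=> i /=; rewrite eqxx fill_top_bot.
Qed.

End Glue.

(** * The recursion and the final parameters *)

Lemma ladder_exists D k : inhabited (ladder D k.*2.+1 (2 ^ 'C(D + k - 1, D))).
Proof.
elim: D k => [|D IHD] k.
  by rewrite bin0; constructor; apply: widen_ladder flat_ladder.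
elim: k => [|k [G2]].
  rewrite addn0 subn1 bin_small //; constructor; exact: trivial_ladder.
(* Ladders for [(D, k + 1)] and [(D + 1, k)] are glued: their exponents add up by Pascal's rule and
   their widths differ by exactly 2. *)
have [G1] := IHD k.+1; rewrite addnS subn1 addSn binS expnD mulnC.
move: G1 G2; rewrite addnS addSn !subn1 => G1 G2.
by constructor; apply: glue G1 G2 _.
Qed.

Lemma contains_half_graph_leq (G : sgraph) d l l' :
  l' <= l -> contains_half_graph G d l -> contains_half_graph G d l'.
Proof.
move=> le_l [a [b [a_inj b_inj ab ltP]]].
have w_inj : injective (widen_ord le_l) by move=> i j /(congr1 val) /= /val_inj.
exists (a \o widen_ord le_l), (b \o widen_ord le_l); split.
- exact: inj_comp.
- exact: inj_comp.
- by move=> i j; apply: ab.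
- by move=> i j; rewrite ltP.
Qed.

Theorem theorem3p17 (d t : nat) (d_ge2 : 2 <= d) (d_even : ~~ odd d)
    (t_ge5 : 5 <= t) (t_odd : odd t) :
  exists G : sgraph,
    ~ contains_minor (complete_graph t) G /\
    contains_half_graph G d (2 ^ 'C((d + t - 7)./2, (t - 5)./2)).
Proof.
have [D dE] : exists D, d = D.*2 by exists d./2; lia.
have [k tE] : exists k, t = k.*2 + 5 by exists (t - 5)./2; lia.
have D_gt0 : 0 < D by lia.
(* The width is [2k + 3], and [2k + 4 < t = 2k + 5]. *)
have [G] := ladder_exists D k.+1; exists G; split.
  apply: no_complete_minor (fill_elim G) (@fill_adj _ _ _ G) _; lia.
have -> : (d + t - 7)./2 = D + k - 1 by lia.
have -> : (t - 5)./2 = k by lia.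
(* The ladder has exponent ['C(D + k, k)], at least the requested ['C(D + k - 1, k)]. *)
apply: (@contains_half_graph_leq _ _ (2 ^ 'C(D + k.+1 - 1, D))).
  have -> : 'C(D + k.+1 - 1, D) = 'C(D + k, k).
    by rewrite addnS subn1 -bin_sub ?leq_addr // addKn.
  by rewrite leq_exp2l // leq_bin2l // leq_subr.
by rewrite dE; exists (@top _ _ _ G), (@bot _ _ _ G); apply: ladder_half_graph.
Qed.
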